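(* Let $p$ be a prime number. A divisible Abelian $p$-group is perspective if and only if it has finite rank. As such, it is isomorphic to a finite direct sum of copies of $\mathbb{Z}(p^{\infty})$.
   Context: An Abelian group $G$ is called perspective if any two isomorphic direct summands of $G$ have a common direct complement: whenever $G=A\oplus H=B\oplus K$ with $A\cong B$, there exists a subgroup $C\le G$ with $G=A\oplus C=B\oplus C$. $\mathbb{Z}(p^{\infty})$ denotes the quasicyclic (Prüfer) $p$-group. The rank of a $p$-group is the dimension over $\mathbb{F}_p$ of its socle. *)

(* Defs.v *)
From HB Require Import structures.
From mathcomp Require Import all_boot all_order all_algebra.
From mathcomp Require Import boolp classical_sets functions.

Set Implicit Arguments.
Unset Strict Implicit.
Unset Printing Implicit Defensive.

Import GRing.Theory Num.Theory.
Local Open Scope classical_set_scope.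
Local Open Scope ring_scope.

Definition subgroup (G : zmodType) (A : set G) : Prop := zmod_closed [in A].

Definition direct_sum (G : zmodType) (A B : set G) : Prop :=
  [/\ subgroup A, subgroup B,
      forall x, exists a b, [/\ A a, B b & x = a + b]
    & A `&` B = [set 0]].

(* Only the restriction of f to A matters; its values elsewhere are
   arbitrary. *)
Definition subgroup_isomorphic (G : zmodType) (A B : set G) : Prop :=
  exists f : G -> G,
    {in A &, {morph f : x y / x + y}} /\ set_bij A B f.

Definition perspective (G : zmodType) : Prop :=
  forall A H B K : set G,
    direct_sum A H -> direct_sum B K -> subgroup_isomorphic A B ->
    exists C : set G, direct_sum A C /\ direct_sum B C.

Definition divisible (G : zmodType) : Prop :=
  forall (n : nat) (x : G), (0 < n)%N -> exists y : G, y *+ n = x.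

Definition isomorphic (G H : zmodType) : Prop :=
  exists f : {additive G -> H}, bijective f.

Section PrimaryComponent.
Variables (p : nat) (G : zmodType).

Definition primary_pred : {pred G} :=
  fun x => `[< exists k : nat, x *+ (p ^ k)%N = 0 >].

Lemma primary_pred_closed : zmod_closed primary_pred.
Proof.
split=> [|x y /asboolP[k xk] /asboolP[l yl]].
  by apply/asboolP; exists 0%N; rewrite mul0rn.
apply/asboolP; exists (k + l)%N; rewrite expnD mulrnBl.
by rewrite mulrnA xk mul0rn mulnC mulrnA yl mul0rn subrr.
Qed.

HB.instance Definition _ :=
  GRing.isZmodClosed.Build G primary_pred primary_pred_closed.

Record primary : Type :=
  Primary { primary_val : G; _ : primary_pred primary_val }.

HB.instance Definition _ := [isSub for primary_val].
HB.instance Definition _ := [Choice of primary by <:].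
HB.instance Definition _ := [SubChoice_isSubZmodule of primary by <:].

End PrimaryComponent.

Definition p_group (p : nat) (G : zmodType) : Prop :=
  forall x : G, exists k : nat, x *+ (p ^ k)%N = 0.

(* Num.int_num_subdef is the predicate underlying the qualifier Num.int. *)
Definition QmodZ : zmodType :=
  Quotient.quot (Num.int_num_subdef : {pred rat}).

(* Z(p^oo) is the p-primary component of Q/Z, that is Z[1/p]/Z. *)
Definition prufer (p : nat) : zmodType := primary p QmodZ.

(* The primality proof is a parameter so that 'F_p is the field of p elements:
   in MathComp 'F_p denotes 'Z_(pdiv p) for an arbitrary p. *)
Section Socle.
Variables (p : nat) (p_pr : prime p) (G : zmodType).

Definition socle_pred : {pred G} := fun x => x *+ p == 0.

Lemma socle_pred_closed : zmod_closed socle_pred.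
Proof.
split=> [|x y /eqP xp /eqP yp]; apply/eqP; first by rewrite mul0rn.
by rewrite mulrnBl xp yp subrr.
Qed.

HB.instance Definition _ :=
  GRing.isZmodClosed.Build G socle_pred socle_pred_closed.

(* For a p-group G, the sum of the minimal subgroups is G[p]. *)
Record socle (pr : prime p) : Type :=
  Socle { socle_val : G; _ : socle_pred socle_val }.

HB.instance Definition _ := [isSub for @socle_val p_pr].
HB.instance Definition _ := [Choice of socle p_pr by <:].
HB.instance Definition _ := [SubChoice_isSubZmodule of socle p_pr by <:].

Definition socle_scale (a : 'F_p) (x : socle p_pr) : socle p_pr :=
  x *+ (a : nat).

Lemma socle_mulrn_mod (x : socle p_pr) (n : nat) : x *+ (n %% p)%N = x *+ n.
Proof.
have xp : x *+ p = 0.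
  by apply: val_inj; rewrite raddfMn raddf0; case: x => x px; exact/eqP.
by rewrite [in RHS](divn_eq n p) mulrnDr mulnC mulrnA xp mul0rn add0r.
Qed.

Lemma socle_scaleA a b x :
  socle_scale a (socle_scale b x) = socle_scale (a * b) x.
Proof.
rewrite /socle_scale.
have -> : nat_of_ord (a * b) = ((a * b) %% p)%N.
  exact: (congr1 (modn (a * b)%N) (Fp_cast p_pr)).
by rewrite socle_mulrn_mod mulnC mulrnA.
Qed.

Lemma socle_scale1 : left_id 1 socle_scale.
Proof. by move=> x. Qed.

Lemma socle_scaleDr : right_distributive socle_scale +%R.
Proof. by move=> a x y; rewrite /socle_scale mulrnDl. Qed.

Lemma socle_scaleDl x : {morph socle_scale^~ x : a b / a + b}.
Proof.
move=> a b; rewrite /socle_scale.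
have -> : nat_of_ord (a + b) = ((a + b) %% p)%N.
  exact: (congr1 (modn (a + b)%N) (Fp_cast p_pr)).
by rewrite socle_mulrn_mod mulrnDr.
Qed.

HB.instance Definition _ := GRing.Zmodule_isLmodule.Build 'F_p (socle p_pr)
  socle_scaleA socle_scale1 socle_scaleDr socle_scaleDl.

End Socle.

Arguments socle {p} G pr.

Definition rank_eq (p : nat) (p_pr : prime p) (G : zmodType) (n : nat) : Prop :=
  inhabited (Vector.axiom n (socle G p_pr : lmodType 'F_p)).

Definition finite_rank (p : nat) (p_pr : prime p) (G : zmodType) : Prop :=
  exists n : nat, rank_eq p_pr G n.

(* Main.v *)
Require Import Defs.
From HB Require Import structures.
From mathcomp Require Import all_boot all_order all_algebra all_field zify.
From mathcomp Require Import boolp classical_sets functions.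

Set Implicit Arguments.
Unset Strict Implicit.
Unset Printing Implicit Defensive.

Import GRing.Theory Num.Theory.
Local Open Scope classical_set_scope.
Local Open Scope ring_scope.

(** A p-group is governed by its socle G[p], an F_p-vector space: a homomorphism
    from a p-group is injective as soon as it is injective on the socle, and it
    is surjective onto a p-group as soon as its domain is p-divisible and its
    image contains the socle.  Since a divisible group is injective
    ([hom_extension]), every linear map between socles of divisible p-groups
    lifts to a homomorphism of the groups, and the proposition becomes linear
    algebra over F_p.

    Structure.  If G[p] has dimension n, lift an isomorphism from G[p] onto the
    socle of the direct sum of n Pruefer groups; the lift is bijective
    ([finite_rank_isomorphic]).

    Finite rank implies perspective.  Let G = A + H = B + K be direct sums with
    A and B isomorphic.  Then A[p] and B[p] are subspaces of G[p] of the same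
    dimension, so they have a common complement W
    ([vspace_common_complement]).  Lift to G the projection of G[p] onto W
    along A[p]: the lift is injective on H, so C, the image of H, is divisible
    and has socle W ([p_divisible_lift]).  A divisible subgroup whose socle is W
    is a direct complement of both A and B ([direct_sum_of_complementary]).

    Perspective implies finite rank.  A perspective group is Dedekind-finite: if
    f has a left inverse, then f(G) is a summand isomorphic to G, and a common
    complement of f(G) and G has to be 0 ([perspective_dedekind]).  If G[p] is
    infinite-dimensional, it contains a copy of F_p[X], which is a direct
    summand of it, so multiplication by X on that copy and the identity on a
    complement give an injective, non-surjective endomorphism of G[p].  Its lift
    to G is injective but not surjective ([infinite_rank_shift]), and it has a
    left inverse because G is injective. *)

(** * Subgroups and p-divisibility *)

Definition p_divisible (p : nat) (G : zmodType) : Prop :=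
  forall x : G, exists y : G, y *+ p = x.

Lemma subgroupP (G : zmodType) (A : set G) :
  subgroup A <-> A 0 /\ forall x y, A x -> A y -> A (x - y).
Proof.
split=> [[A0 AB]|[A0 AB]]; split=> [|x y].
- by apply/set_mem.
- by move=> /mem_set Ax /mem_set Ay; apply/set_mem; exact: AB.
- by apply/mem_set.
- by move=> /set_mem Ax /set_mem Ay; apply/mem_set; exact: AB.
Qed.

Section Subgroup.
Variables (G : zmodType) (A : set G).
Hypothesis sA : subgroup A.

Lemma subgroup0 : A 0.
Proof. by case/subgroupP: sA. Qed.

Lemma subgroupB x y : A x -> A y -> A (x - y).
Proof. by case/subgroupP: sA => _; apply. Qed.

Lemma subgroupN x : A x -> A (- x).
Proof. by move=> Ax; rewrite -sub0r; exact: subgroupB subgroup0 Ax. Qed.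

Lemma subgroupD x y : A x -> A y -> A (x + y).
Proof. by move=> Ax /subgroupN Ay; rewrite -[y]opprK; exact: subgroupB. Qed.

Lemma subgroupMn x n : A x -> A (x *+ n).
Proof.
move=> Ax; elim: n => [|n IHn]; first by rewrite mulr0n; exact: subgroup0.
by rewrite mulrS; exact: subgroupD.
Qed.

Lemma subgroupMz x (n : int) : A x -> A (x *~ n).
Proof.
by move=> Ax; case: n => n; [exact: subgroupMn | exact/subgroupN/subgroupMn].
Qed.
End Subgroup.

Lemma subgroup_image (S G : zmodType) (f : {additive S -> G}) (A : set S) :
  subgroup A -> subgroup (f @` A).
Proof.
move=> sA; apply/subgroupP; split.
  by exists 0; rewrite ?raddf0 //; exact: subgroup0.
move=> _ _ [a Aa <-] [b Ab <-]; exists (a - b); last by rewrite raddfB.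
exact: subgroupB.
Qed.

(** The multiples x, p x, p^2 x, ... of an element of a p-group reach 0, so
    they enter A. Applied to a missing element, it reduces statements about
    p-groups to elements x with p x in A. *)
Lemma p_multiple_exit (p : nat) (G : zmodType) (A : set G) (x : G) :
  p_group p G -> A 0 -> ~ A x ->
  exists k, ~ A (x *+ p ^ k) /\ A (x *+ p ^ k *+ p).
Proof.
move=> pG A0 nAx; case: (pG x) => k xk0.
have Axk : A (x *+ p ^ k) by rewrite xk0.
elim: k {xk0} Axk => [|k IHk]; first by rewrite expn0 mulr1n.
have [/IHk//|nAk] := pselect (A (x *+ p ^ k)).
by rewrite expnSr mulrnA; exists k.
Qed.

(** * Divisible groups are injective *)

Section Extension.
Variables (p : nat) (p_pr : prime p) (D E : zmodType).
Hypothesis pD : p_group p D.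
Hypothesis divE : forall x : D, x *+ p <> 0 -> p_divisible p E.

(** Partial homomorphisms are encoded by their graphs, so that extension is
    inclusion and the union of a chain needs no gluing. *)
Definition partial_hom (g : set (D * E)) : Prop :=
  subgroup g /\ forall e, g (0, e) -> e = 0.

Definition graph_span (g : set (D * E)) (z : D * E) : set (D * E) :=
  [set u | exists n : int, g (u - z *~ n)].

(** If p y is in the domain of g and y is not, the integers n with n y in the
    domain are exactly the multiples of p, because p is prime. Hence y may be
    sent to any e such that p e is the value already prescribed at p y. *)
Lemma partial_hom_span g y e :
  partial_hom g -> ~ (exists c, g (y, c)) -> g ((y, e) *+ p) ->
  partial_hom (graph_span g (y, e)).
Proof.
move=> [sg fg] ndom gp; split.
  apply/subgroupP; split; first by exists 0; rewrite mulr0z subr0;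
    exact: subgroup0.
  move=> u v [m gu] [n gv]; exists (m - n).
  by rewrite mulrzBr opprD addrACA -opprD; exact: subgroupB.
move=> c [n gn].
have [pn|npn] := boolP (p%:Z %| n)%Z.
  apply: fg; case/dvdzP: pn gn => m ->; rewrite mulrC mulrzA => gn.
  by rewrite -[(0, c)](subrK ((y, e) *~ p *~ m)); apply: subgroupD gn _ => //;
    exact: subgroupMz.
case: ndom.
(* If p does not divide n, a Bezout combination of n y and p y puts y itself
   in the domain. *)
have [u [v uv]] := Bezoutz n p.
have n1 : gcdz n p = 1.
  rewrite /gcdz /=; congr Posz; apply/eqP; rewrite -/(coprime _ _) coprime_sym.
  by rewrite prime_coprime.
pose w := ((0, c) - (y, e) *~ n) *~ - u + (y, e) *+ p *~ v.
have gw : g w by apply: subgroupD => //; apply: subgroupMz.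
exists w.2; suff <- : w.1 = y by case: (w) gw.
have fstMz (z : D * E) m : (z *~ m).1 = z.1 *~ m by exact: raddfMz.
have fstMn (z : D * E) m : (z *+ m).1 = z.1 *+ m by exact: raddfMn.
have fstD (a b : D * E) : (a + b).1 = a.1 + b.1 by [].
have fstN (a : D * E) : (- a).1 = - a.1 by [].
rewrite /w !(fstD, fstN, fstMz, fstMn) add0r mulNrz mulrNz opprK.
by rewrite pmulrn -!mulrzA -mulrzDr mulrC [p%:Z * v]mulrC uv n1.
Qed.

(** Zorn's lemma is applied to the sets X such that the union of g0 and X is a
    partial homomorphism: the empty chain then has an upper bound, and
    maximality is among the extensions of g0. *)
Lemma maximal_partial_hom g0 : partial_hom g0 ->
  exists g, [/\ partial_hom g, g0 `<=` g &
    forall h, partial_hom h -> g `<=` h -> h `<=` g].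
Proof.
move=> hg0.
have [|X [hX maxX]] := @Zorn_bigcup _ [set X | partial_hom (g0 `|` X)].
  move=> F Fh Ftot.
  have hull (u v : D * E) : (g0 `|` \bigcup_(X in F) X) u ->
    (g0 `|` \bigcup_(X in F) X) v ->
      exists h, [/\ partial_hom h, h u, h v & h `<=` g0 `|` \bigcup_(X in F) X].
    have sub X : F X -> g0 `|` X `<=` g0 `|` \bigcup_(Y in F) Y.
      by move=> FX; apply: setUS; exact: bigcup_sup.
    move=> [gu|[X FX Xu]] [gv|[Y FY Yv]].
    - by exists g0; split=> // x; left.
    - by exists (g0 `|` Y); split; [exact: Fh | left | right | exact: sub].
    - by exists (g0 `|` X); split; [exact: Fh | right | left | exact: sub].
    - have [XY|YX] := Ftot _ _ FX FY.
        by exists (g0 `|` Y); split;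
          [exact: Fh | right; apply: XY | right | exact: sub].
      by exists (g0 `|` X); split;
        [exact: Fh | right | right; apply: YX | exact: sub].
  split.
    apply/subgroupP; split; first by left; case: hg0 => /subgroup0.
    move=> u v /hull Fu /Fu[h [[sh _] hu hv]]; apply.
    exact: subgroupB.
  by move=> e ge; case: (hull _ _ ge ge) => h [[_ fh] /fh].
exists (g0 `|` X); split=> // h hh Xh x hx.
apply: contrapT => nx; apply: (maxX (X `|` h)).
  split=> [y Xy|/(_ x (or_intror hx)) Xx]; first by left.
  by apply: nx; right.
by rewrite /= setUA (setUidPr _ _).2.
Qed.

(** Baer's criterion for p-groups: a maximal partial homomorphism is total,
    since an element x outside its domain may be chosen with p x in the
    domain, and then only a division by p in E is required. The hypothesis
    [divE] asks for this division only when D is not killed by p, so that the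
    lemma also covers linear maps between vector spaces over F_p. *)
Lemma hom_extension (S : zmodType)
    (i : {additive S -> D}) (g : {additive S -> E}) :
  injective i -> exists f : {additive D -> E}, forall s, f (i s) = g s.
Proof.
move=> inji; pose g0 := [set u | exists s, u = (i s, g s)].
have [|h [[sh fh] g0h maxh]] := @maximal_partial_hom g0.
  split.
    apply/subgroupP; split; first by exists 0; rewrite !raddf0.
    by move=> _ _ [s ->] [t ->]; exists (s - t); rewrite !raddfB.
  move=> e [s [/esym is0 ->]]; suff -> : s = 0 by rewrite raddf0.
  by apply: inji; rewrite raddf0.
have /choice[f hf] x : exists c, h (x, c).
  apply: contrapT => ndom.
  have dom0 : [set x | exists c, h (x, c)] 0 by exists 0; exact: (subgroup0 sh).
  have [k [ndy [c gc]]] := p_multiple_exit pD dom0 ndom.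
  set y := x *+ p ^ k in ndy gc.
  have [e ec] : exists e, e *+ p = c.
    have [py0|/divE] := pselect (y *+ p = 0); last exact.
    by exists 0; rewrite py0 in gc; rewrite mul0rn (fh _ gc).
  have hye : h ((y, e) *+ p).
    suff -> : (y, e) *+ p = (y *+ p, c) by [].
    by rewrite -ec [LHS]surjective_pairing; congr pair; exact: raddfMn.
  apply: (ndy); exists e; apply: (maxh (graph_span h (y, e)) _ _ (y, e)).
  - exact: partial_hom_span.
  - by move=> u hu; exists 0; rewrite mulr0z subr0.
  - by exists 1; rewrite mulr1z subrr; exact: subgroup0.
have uniqh x c : h (x, c) -> c = f x.
  move=> hc; apply/eqP; rewrite -subr_eq0; apply/eqP/fh.
  by rewrite -(subrr x); exact: (subgroupB sh hc (hf x)).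
have fB : zmod_morphism f.
  by move=> x y; apply/esym/uniqh; exact: (subgroupB sh (hf x) (hf y)).
pose F : {additive D -> E} := HB.pack f (GRing.isZmodMorphism.Build D E f fB).
by exists F => s; apply/esym/uniqh/g0h; exists s.
Qed.

End Extension.

(** * Homomorphisms and subgroups controlled by the socle *)

(** A nonzero element of a p-group has a nonzero multiple in the socle. *)
Lemma p_subgroup_trivial p (G : zmodType) (A : set G) :
  p_group p G -> subgroup A -> (forall x, A x -> x *+ p = 0 -> x = 0) ->
  forall x, A x -> x = 0.
Proof.
move=> pG sA A1 x Ax; apply: contrapT => x0.
have [k [xk0 xk1]] := @p_multiple_exit p G [set 0] x pG erefl x0.
by apply: xk0; apply: A1 xk1; exact: subgroupMn.
Qed.

(** An element x outside A has a multiple y outside A with p y in A. Then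
    p y = p a for some a in A, so y - a is in the socle, hence in A, a
    contradiction. *)
Lemma p_subgroup_full p (G : zmodType) (A : set G) :
  p_group p G -> subgroup A ->
  (forall x, A x -> exists2 y, A y & y *+ p = x) ->
  (forall x, x *+ p = 0 -> A x) -> forall x, A x.
Proof.
move=> pG sA divA socA x; apply: contrapT => nAx.
have [k [nAy /divA[a Aa ay]]] := p_multiple_exit pG (subgroup0 sA) nAx.
apply: nAy; rewrite -[_ *+ _](subrK a); apply: subgroupD => //.
by apply: socA; rewrite mulrnBl ay subrr.
Qed.

Section Morphism.
Variables (p : nat) (D E : zmodType) (f : {additive D -> E}).

Lemma injective_on_socle :
  p_group p D -> (forall x, x *+ p = 0 -> f x = 0 -> x = 0) -> injective f.
Proof.
move=> pD inj0; apply: raddf_inj.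
apply: (@p_subgroup_trivial p D [set x | f x = 0]) => //; last first.
  by move=> x fx xp; exact: inj0.
apply/subgroupP; split=> [|x y /= fx fy]; first exact: raddf0.
by rewrite raddfB fx fy subrr.
Qed.

Lemma surjective_on_socle :
  p_divisible p D -> p_group p E ->
  (forall y, y *+ p = 0 -> exists x, f x = y) -> forall y, exists x, f x = y.
Proof.
move=> divD pE surj0.
apply: (@p_subgroup_full p E [set y | exists x, f x = y]) => //.
  apply/subgroupP; split=> [|_ _ [x <-] [y <-]]; first by exists 0;
    exact: raddf0.
  by exists (x - y); rewrite raddfB.
move=> _ [x <-]; have [y <-] := divD x.
by exists (f y); [exists y | rewrite raddfMn].
Qed.

End Morphism.

Lemma socle_mulrn p (p_pr : prime p) (G : zmodType) (x : socle G p_pr) :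
  x *+ p = 0.
Proof.
by apply: val_inj; rewrite raddfMn raddf0; apply/eqP; exact: (valP x).
Qed.

(** * The Pruefer group *)

Section Prufer.
Variables (p : nat) (p_pr : prime p).

Let pQ_neq0 : p%:R != 0 :> rat.
Proof. by rewrite pnatr_eq0 -lt0n prime_gt0. Qed.

Definition rat_class (q : rat) : QmodZ :=
  (\pi_(Quotient.quot (Num.int_num_subdef : {pred rat})) q)%qT.

Lemma rat_class_is_additive : zmod_morphism rat_class.
Proof. exact: raddfB. Qed.

HB.instance Definition _ :=
  GRing.isZmodMorphism.Build rat QmodZ rat_class rat_class_is_additive.

Lemma rat_class_surj (x : QmodZ) : exists q, x = rat_class q.
Proof. by exists (repr x); rewrite /rat_class reprK. Qed.

Lemma rat_class_eq0 q : rat_class q = 0 <-> q \is a Num.int.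
Proof.
rewrite -(raddf0 rat_class) -[X in X \is a _]subr0.
split=> [/eqP|qZ]; first by rewrite -Quotient.idealrBE.
by apply/eqP; rewrite -Quotient.idealrBE.
Qed.

Lemma prufer_p_group : p_group p (prufer p).
Proof.
move=> x; case/asboolP: (valP x) => k xk; exists k.
by apply: val_inj; rewrite raddfMn raddf0.
Qed.

Lemma prufer_p_divisible : p_divisible p (prufer p).
Proof.
move=> x; have [q xq] := rat_class_surj (val x).
have qp : rat_class (q / p%:R) *+ p = val x.
  by rewrite xq -raddfMn -[_ *+ p]mulr_natr divfK.
have Py : primary_pred p (rat_class (q / p%:R)).
  have [k xk] := prufer_p_group x; apply/asboolP; exists k.+1.
  by rewrite expnS mulrnA qp -raddfMn xk raddf0.
by exists (Primary Py); apply: val_inj; rewrite raddfMn.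
Qed.

(** The socle of Z(p^oo) is the line spanned by the class of 1/p: if p q is an
    integer m, then q = m (1/p). *)
Lemma prufer_socle_line :
  exists2 u : socle (prufer p) p_pr, u != 0 &
    forall x, exists c : 'F_p, x = c *: u.
Proof.
have up : rat_class p%:R^-1 *+ p = 0.
  by rewrite -raddfMn; apply/rat_class_eq0;
    rewrite -[_^-1 *+ p]mulr_natr mulVf // rpred1.
have Pu : primary_pred p (rat_class p%:R^-1).
  by apply/asboolP; exists 1%N; rewrite expn1.
have Su : socle_pred p (Primary Pu : prufer p).
  by apply/eqP/val_inj; rewrite raddfMn.
exists (Socle p_pr Su) => [|x].
  apply/eqP => /(congr1 val); rewrite raddf0 => /(congr1 val).
  rewrite raddf0 => /rat_class_eq0 /intrP[m /(congr1 (fun q => q * p%:R))].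
  rewrite mulVf // pmulrn -rmorphM /= -[1]/(1%:~R) => /eqP.
  rewrite eqr_int => /eqP /esym m1.
  suff: (p %| 1)%N by rewrite dvdn1 => /eqP p1; move: p_pr; rewrite p1.
  by rewrite -[(p %| 1)%N]/(p%:Z %| 1%R)%Z -m1 dvdz_mull.
have [q xq] := rat_class_surj (val (val x)).
have /rat_class_eq0 : rat_class (q * p%:R) = 0.
  have -> : rat_class (q * p%:R) = rat_class q *+ p.
    by rewrite mulr_natr raddfMn.
  by rewrite -xq -!raddfMn socle_mulrn !raddf0.
move=> /intrP[m qm]; exists m%:~R; rewrite scaler_int.
apply: val_inj; rewrite raddfMz; apply: val_inj; rewrite raddfMz /= xq -raddfMz.
by congr (rat_class _); rewrite -[q](mulfK pQ_neq0) qm mulrzl.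
Qed.
End Prufer.

(** * Independent sequences *)

Section IndependentSequence.
Variables (F : fieldType) (V : lmodType F).

Definition in_span (s : seq V) (v : V) : Prop :=
  exists c : nat -> F, v = \sum_(i < size s) c i *: s`_i.

(** Each term is chosen outside the span of the previous ones as long as that
    is possible. So either the sequence is independent, or some initial
    segment of it is a basis. *)
Lemma greedy_sequence : exists e : nat -> V,
  forall n, in_span (mkseq e n) (e n) -> forall v, in_span (mkseq e n) v.
Proof.
have /choice[f fP] (s : seq V) :
    exists v, in_span s v -> forall w, in_span s w.
  have [all_s|/existsNP[v nv]] := pselect (forall w, in_span s w).
    by exists 0.
  by exists v => /nv.
pose L := fix L n := if n is m.+1 then rcons (L m) (f (L m)) else [::].
exists (f \o L) => n.
suff -> : mkseq (f \o L) n = L n by exact: fP.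
by elim: n => // n IHn; rewrite mkseqS IHn.
Qed.

Variable e : nat -> V.

Lemma in_spanP n v : in_span (mkseq e n) v <->
  exists c : nat -> F, v = \sum_(i < n) c i *: e i.
Proof.
have spanE (c : nat -> F) :
    \sum_(i < size (mkseq e n)) c i *: (mkseq e n)`_i = \sum_(i < n) c i *: e i.
  by rewrite size_mkseq; apply: eq_bigr => i _; rewrite nth_mkseq.
by split=> -[c ->]; exists c; rewrite spanE.
Qed.

(** The last nonzero coefficient of a relation would put its vector in the span
    of the previous ones. *)
Lemma independent_coef0 n (c : nat -> F) :
  (forall i, (i < n)%N -> ~ in_span (mkseq e i) (e i)) ->
  \sum_(i < n) c i *: e i = 0 -> forall i, (i < n)%N -> c i = 0.
Proof.
elim: n => // n IHn ind; rewrite big_ord_recr /= => sum0.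
have cn0 : c n = 0.
  apply/eqP; apply: contrapT => /negP cn; apply: (ind n (ltnSn n)).
  apply/in_spanP; exists (fun i => - (c n)^-1 * c i).
  under eq_bigr => i _ do rewrite -scalerA.
  rewrite -scaler_sumr (eqP (_ : \sum_(i < n) c i *: e i == - (c n *: e n))).
    by rewrite scalerN scaleNr opprK scalerA mulVf ?scale1r.
  by rewrite -addr_eq0 sum0.
move=> i; rewrite ltnS leq_eqVlt => /predU1P[->//|]; apply: IHn => [j jn|].
  by apply: ind; exact: ltnW.
by move: sum0; rewrite cn0 scale0r addr0.
Qed.

(** The space F[X] serves as the model of countable dimension, because
    multiplication by X is the shift on its basis of monomials. *)
Lemma independent_poly_embedding :
  (forall n, ~ in_span (mkseq e n) (e n)) ->
  exists eps : {additive {poly F} -> V}, injective eps.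
Proof.
move=> ind; pose eps (q : {poly F}) := \sum_(i < size q) q`_i *: e i.
have epsE (q : {poly F}) N : (size q <= N)%N ->
  eps q = \sum_(i < N) q`_i *: e i.
  move=> qN; rewrite /eps (big_ord_widen _ (fun i => q`_i *: e i) qN).
  rewrite big_mkcond; apply: eq_bigr => i _; case: ltnP => // qi.
  by rewrite nth_default ?scale0r.
have epsB : zmod_morphism eps.
  move=> q r; pose N := maxn (size q) (size r).
  rewrite (epsE q N) ?leq_maxl // (epsE r N) ?leq_maxr // (epsE _ N).
    by rewrite -sumrB; apply: eq_bigr => i _; rewrite coefB scalerBl.
  by rewrite (leq_trans (size_polyD _ _)) // size_polyN.
pose E : {additive {poly F} -> V} :=
  HB.pack eps (GRing.isZmodMorphism.Build _ _ eps epsB).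
exists E; apply: raddf_inj => q q0; apply/polyP => i; rewrite coef0.
have [iq|qi] := ltnP i (size q); last by rewrite nth_default.
exact: (independent_coef0 (fun i _ => ind i) q0).
Qed.

Lemma independent_basis n :
  (forall i, (i < n)%N -> ~ in_span (mkseq e i) (e i)) ->
  (forall v, in_span (mkseq e n) v) -> inhabited (Vector.axiom n V).
Proof.
move=> ind gen; pose g (r : 'rV[F]_n) := \sum_(i < n) r 0 i *: e i.
have glin : linear g.
  move=> a r s; rewrite /g scaler_sumr -big_split; apply: eq_bigr => i _ /=.
  by rewrite !mxE scalerDl scalerA.
pose G : {linear 'rV[F]_n -> V} :=
  HB.pack g (GRing.isLinear.Build _ _ _ _ g glin).
have injg : injective G.
  apply: raddf_inj => r r0; apply/rowP => i; rewrite mxE.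
  (* A sequence of coefficients extending r, with default value 0 from n on. *)
  pose c j := if insub j is Some k then r 0 k else 0.
  have cE (k : 'I_n) : c k = r 0 k by rewrite /c valK.
  rewrite -cE; apply: (independent_coef0 ind) => //.
  by rewrite -[RHS]r0; apply: eq_bigr => k _; rewrite cE.
have /choice[h gh] v : exists r, G r = v.
  have /in_spanP[c ->] := gen v; exists (\row_i c i).
  by apply: eq_bigr => i _; rewrite mxE.
have hg : cancel G h by move=> r; apply: injg; rewrite gh.
constructor; exists h; first exact: (can2_linear hg gh).
by exists G.
Qed.

End IndependentSequence.

(** The first term of a greedy sequence that lies in the span of its
    predecessors, if there is one, marks the end of a basis. *)
Lemma finite_dim_or_poly_embedding (F : fieldType) (V : lmodType F) :
  (exists n, inhabited (Vector.axiom n V)) \/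
  (exists eps : {additive {poly F} -> V}, injective eps).
Proof.
have [e eP] := greedy_sequence V.
have [ind|/existsNP[n /contrapT en]] :=
  pselect (forall n, ~ in_span (mkseq e n) (e n)).
  by right; exact: (independent_poly_embedding ind).
left; have ex : exists n, `[< in_span (mkseq e n) (e n) >].
  by exists n; apply/asboolP.
case: (ex_minnP ex) => m /asboolP em minm; exists m.
apply: (independent_basis (e := e)) => [i im /asboolP /minm|v]; last exact: eP.
by rewrite leqNgt im.
Qed.

(** * Common complements of subspaces *)

Section CommonComplement.
Variables (K : fieldType) (vT : vectType K).
Implicit Types U V W : {vspace vT}.

Definition complementary U W : Prop :=
  (U + W)%VS = fullv /\ (U :&: W)%VS = 0%VS.

Lemma dimv_addv_line U (v : vT) : v \notin U -> \dim (U + <[v]>) = (\dim U).+1.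
Proof.
move=> vU; rewrite dimv_disjoint_sum ?dim_vline.
  by rewrite (_ : v != 0) ?addn1 //; apply: contraNneq vU => ->; exact: mem0v.
apply/eqP; rewrite -subv0; apply/subvP => w /memv_capP[wU /vlineP[a wa]].
rewrite memv0 wa; have [->|a0] := eqVneq a 0; first by rewrite scale0r.
by case/negP: vU; rewrite -[v](scalerK a0) -wa rpredZ.
Qed.

(** The sum is the same on both sides, and the dimension of W grows by at most
    one, so the intersection is trivial for lack of dimension. *)
Lemma complementary_addv_line U W (v : vT) :
  v \notin U -> complementary (U + <[v]>) W -> complementary U (W + <[v]>).
Proof.
move=> vU [UW UW0].
have UWv : (U + (W + <[v]>))%VS = fullv by rewrite (addvC W) addvA.
split=> //; apply/eqP; rewrite -dimv_eq0.
have dimW : (\dim (W + <[v]>) <= (\dim W).+1)%N.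
  rewrite (leq_trans (dimv_add_leqif _ _)) // dim_vline -addn1.
  by rewrite leq_add2l leq_b1.
have := dimv_sum_cap (U + <[v]>) W; have := dimv_sum_cap U (W + <[v]>).
by rewrite UWv UW UW0 dimv0 (dimv_addv_line vU); lia.
Qed.

(** If x outside U lies in V and y outside V lies in U, then x + y is outside
    both. *)
Lemma vspace_avoid2 U V : U != fullv -> V != fullv ->
  exists2 v, v \notin U & v \notin V.
Proof.
have out Z : Z != fullv -> exists v, v \notin Z.
  by rewrite eqEsubv subvf => /subvPn[v _ vZ]; exists v.
move=> /out[x xU] /out[y yV].
have [xV|] := boolP (x \in V); last by exists x.
have [yU|] := boolP (y \in U); last by exists y.
by exists (x + y); [rewrite rpredDr | rewrite rpredDl].
Qed.

(** Induction on the codimension: a vector v outside both subspaces enlarges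
    both of them by a line, and v is added to a common complement of the
    larger ones. *)
Lemma vspace_common_complement U V :
  \dim U = \dim V -> exists W, complementary U W /\ complementary V W.
Proof.
move: {2}(\dim {:vT} - \dim U)%N (erefl (\dim {:vT} - \dim U)%N) => m.
elim: m U V => [|m IHm] U V codim dimUV.
  have full (Z : {vspace vT}) : (\dim {:vT} <= \dim Z)%N -> Z = fullv.
    by move=> dZ; apply/eqP; rewrite eqEdim subvf.
  have dU : (\dim {:vT} <= \dim U)%N by rewrite -subn_eq0 codim.
  exists 0%VS; rewrite (full U) // (full V) -?dimUV //.
  by split; split; rewrite ?addv0 ?capv0.
have nfull (Z : {vspace vT}) : \dim Z = \dim U -> Z != fullv.
  by move=> dZ; apply/eqP => Zf; move: codim; rewrite -dZ Zf subnn.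
have [v vU vV] := vspace_avoid2 (nfull U erefl) (nfull V (esym dimUV)).
have [||W [UW VW]] := IHm (U + <[v]>)%VS (V + <[v]>)%VS.
- by rewrite dimv_addv_line // subnS codim.
- by rewrite !dimv_addv_line // dimUV.
by exists (W + <[v]>)%VS; split; exact: complementary_addv_line.
Qed.

End CommonComplement.

(** * Perspective groups have finite rank *)

(** G is the direct sum of f(G) and ker r, and also of G and 0; a common
    complement of f(G) and G is trivial, so f(G) = G: perspective groups are
    Dedekind-finite. *)
Lemma perspective_dedekind (G : zmodType) (f r : {additive G -> G}) :
  perspective G -> cancel f r -> forall y, exists x, f x = y.
Proof.
move=> persp fK.
have s0 : subgroup [set (0 : G)].
  by apply/subgroupP; split=> // x y -> ->; rewrite subrr.
have sT : subgroup [set: G] by apply/subgroupP; split.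
have sumA : direct_sum (f @` setT) [set x | r x = 0].
  split.
  - exact: subgroup_image.
  - apply/subgroupP; split=> [|x y /= rx ry]; first exact: raddf0.
    by rewrite raddfB rx ry subrr.
  - move=> x; exists (f (r x)), (x - f (r x)); split; first by exists (r x).
      by rewrite /= raddfB fK subrr.
    by rewrite addrC subrK.
  - apply/seteqP; split=> [_ [[x _ <-] /=]|_ ->].
      by rewrite fK => ->; rewrite raddf0.
    by split; rewrite /= ?raddf0 //; exists 0; rewrite ?raddf0.
have sumT : direct_sum [set: G] [set 0].
  split=> // [x|]; first by exists x, 0; rewrite addr0.
  by rewrite setTI.
have [|C [[_ _ AC _] [_ _ _ TC]]] := persp _ _ _ _ sumA sumT.
  exists r; split; first by move=> x y _ _; exact: raddfD.
  split=> // [_ _ /set_mem[x _ <-] /set_mem[y _ <-]|x _];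
    first by rewrite !fK => ->.
  by exists (f x); [exists x | rewrite fK].
move=> y; have [a [c [[x _ <-] Cc ->]]] := AC y; exists x.
suff -> : c = 0 by rewrite addr0.
by have : (setT `&` C) c by []; rewrite TC.
Qed.

Section PGroup.
Variables (p : nat) (p_pr : prime p).

Lemma socle_p_group (G : zmodType) : p_group p (socle G p_pr).
Proof. by move=> x; exists 1%N; rewrite expn1 socle_mulrn. Qed.

Lemma socleP (G : zmodType) (x : G) : x *+ p = 0 ->
  exists s : socle G p_pr, x = val s.
Proof. by move=> /eqP xp; exists (Socle p_pr xp). Qed.

Lemma val_socle_mulrn (G : zmodType) (s : socle G p_pr) : val s *+ p = 0.
Proof. by apply/eqP; exact: (valP s). Qed.

(** Over the finite field F_p a subspace of dimension d has p^d elements, so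
    dimensions are compared by counting. *)
Lemma dimv_leq_of_rel n (U V : {vspace 'rV['F_p]_n})
    (R : 'rV['F_p]_n -> 'rV['F_p]_n -> Prop) :
  (forall r, r \in U -> exists2 s, s \in V & R r s) ->
  (forall r r' s, r \in U -> r' \in U -> R r s -> R r' s -> r = r') ->
  (\dim U <= \dim V)%N.
Proof.
move=> totR injR.
have /choice[f fP] r : exists s, r \in U -> s \in V /\ R r s.
  have [rU|] := boolP (r \in U); last by exists 0.
  by have [s sV Rs] := totR r rU; exists s.
have cardF : (1 < #|'F_p|)%N by rewrite card_Fp ?prime_gt1.
rewrite -(leq_exp2l _ _ cardF) -!card_vspace.
rewrite -(@card_in_imset _ _ f U); last first.
  move=> r r' rU r'U frr'; have [_ Rr] := fP r rU; have [_ Rr'] := fP r' r'U.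
  by apply: injR Rr _ => //; rewrite frr'.
by apply/subset_leq_card/fintype.subsetP => _ /imsetP[r rU ->]; case: (fP r rU).
Qed.

Variable G : zmodType.
Hypotheses (divG : p_divisible p G) (pG : p_group p G).

(** With rho a retraction of the socle onto F_p[X], the map s |-> s - eps (rho
    s) + eps (X rho s) is the identity on the kernel of rho and multiplication
    by X on F_p[X]. It misses eps 1, because rho turns it into multiplication
    by X. *)
Lemma infinite_rank_shift (eps : {additive {poly 'F_p} -> socle G p_pr}) :
  injective eps -> exists2 f : {additive G -> G}, injective f &
    exists y, forall x, f x <> y.
Proof.
move=> inj_eps.
have [rho rhoK] : exists rho : {additive socle G p_pr -> {poly 'F_p}},
  forall q, rho (eps q) = q.
  (* The divisibility condition is vacuous, as the socle is killed by p. *)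
  have [x /[!socle_mulrn]//|rho rhoK] :=
    hom_extension p_pr (@socle_p_group G) _ idfun inj_eps.
  by exists rho.
pose phi s := val (s - eps (rho s) + eps ('X * rho s)).
have phiB : zmod_morphism phi.
  move=> s t; rewrite /phi -raddfB; congr (val _).
  by rewrite !raddfB mulrBr raddfB !opprD !opprK [RHS]addrACA; congr (_ + _);
    rewrite addrACA.
pose Phi : {additive socle G p_pr -> G} :=
  HB.pack phi (GRing.isZmodMorphism.Build _ _ phi phiB).
have [f fE] := hom_extension p_pr pG (fun _ _ => divG) Phi val_inj.
have rho_shift s : rho (s - eps (rho s) + eps ('X * rho s)) = 'X * rho s.
  by rewrite raddfD raddfB !rhoK subrr add0r.
have injf : injective f.
  apply: (injective_on_socle pG) => _ /socleP[s ->]; rewrite fE /Phi /phi /=.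
  move=> phis0; have {}phis0 : s - eps (rho s) + eps ('X * rho s) = 0.
    by apply: val_inj; rewrite raddf0.
  have /eqP : 'X * rho s = 0 by rewrite -rho_shift phis0 raddf0.
  rewrite mulf_eq0 polyX_eq0 /= => /eqP rhos.
  rewrite rhos mulr0 raddf0 subr0 addr0 in phis0; rewrite phis0;
    exact: (raddf0 val).
exists f => //; exists (val (eps 1)) => x fx.
have /socleP[s xs] : x *+ p = 0.
  by apply: injf; rewrite raddfMn fx val_socle_mulrn raddf0.
have := fx; rewrite xs fE => /val_inj/(congr1 rho); rewrite rho_shift rhoK.
move=> /(congr1 (fun q : {poly 'F_p} => q`_0)).
by rewrite coefXM coef1 /= => /eqP; rewrite eq_sym oner_eq0.
Qed.

Lemma perspective_finite_rank : perspective G -> finite_rank p_pr G.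
Proof.
move=> persp.
case: (finite_dim_or_poly_embedding (socle G p_pr : lmodType 'F_p)) => //.
move=> [eps /infinite_rank_shift[f injf [y fy]]].
have [r rK] := hom_extension p_pr pG (fun _ _ => divG) idfun injf.
by have [x /fy] := perspective_dedekind persp rK y.
Qed.

(** * Divisible p-groups of finite rank *)

Section FiniteRank.
Variables (n : nat) (coord : {linear socle G p_pr -> 'rV['F_p]_n}).
Variable point : {linear 'rV['F_p]_n -> socle G p_pr}.
Hypotheses (coordK : cancel coord point) (pointK : cancel point coord).

(** The lift sends an element of the socle with coordinates (c_i) to (c_i u),
    where u spans the socle of Z(p^oo). *)
Lemma finite_rank_isomorphic : isomorphic G {ffun 'I_n -> prufer p}.
Proof.
have [u u0 genu] := prufer_socle_line p_pr.
pose th s : {ffun 'I_n -> prufer p} := [ffun i => val (coord s 0 i *: u)].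
have thB : zmod_morphism th.
  move=> s t; apply/ffunP => i.
  have coordB : coord (s - t) 0 i = coord s 0 i - coord t 0 i.
    by rewrite raddfB !mxE.
  by rewrite !ffunE coordB scalerBl raddfB.
pose Th : {additive socle G p_pr -> {ffun 'I_n -> prufer p}} :=
  HB.pack th (GRing.isZmodMorphism.Build _ _ th thB).
have divP : p_divisible p {ffun 'I_n -> prufer p}.
  move=> x; have /choice[y yx] i := prufer_p_divisible p_pr (x i).
  by exists [ffun i => y i]; apply/ffunP => i; rewrite ffunMnE ffunE.
have [f fE] := hom_extension p_pr pG (fun _ _ => divP) Th val_inj.
have injf : injective f.
  apply: (injective_on_socle pG) => _ /socleP[s ->]; rewrite fE => /ffunP th0.
  suff s0 : coord s = 0 by rewrite -(coordK s) s0 !raddf0.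
  apply/rowP => i; rewrite mxE; move: (th0 i); rewrite !ffunE.
  rewrite -(raddf0 (val : socle (prufer p) p_pr -> _)) => /val_inj/eqP.
  by rewrite scaler_eq0 (negPf u0) orbF => /eqP.
have /choice[g fg] : forall y, exists x, f x = y.
  apply: (surjective_on_socle divG) => [x|y yp].
    have /choice[k xk] i := prufer_p_group (x i).
    (* Any common bound of the exponents does; their sum is the simplest. *)
    exists (\sum_i k i)%N; apply/ffunP => i; rewrite ffunMnE ffunE.
    by rewrite (bigD1 i) //= expnD mulrnA xk mul0rn.
  have /choice[c yc] i : exists c : 'F_p, y i = val (c *: u).
    have /socleP[s ys] : y i *+ p = 0 by rewrite -ffunMnE yp ffunE.
    by have [c sc] := genu s; exists c; rewrite ys sc.
  exists (val (point (\row_i c i))); rewrite fE; apply/ffunP => i.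
  by rewrite ffunE pointK mxE yc.
exists f; exists g => [x|//].
by apply: injf; rewrite fg.
Qed.

(** Over the prime field scaling is a repeated addition, so a subgroup of the
    socle is a subspace. *)
Lemma subgroup_vspace (A : set G) : subgroup A ->
  exists U : {vspace 'rV['F_p]_n}, forall r, r \in U <-> A (val (point r)).
Proof.
move=> sA; pose P : pred 'rV['F_p]_n := fun r => `[< A (val (point r)) >].
exists <<enum P>>%VS => r; split=> [rU|Ar]; last first.
  by apply: memv_span; rewrite mem_enum; apply/asboolP.
rewrite (coord_span rU) !raddf_sum; elim/big_ind: _ => [|x y Ax Ay|i _].
- exact: subgroup0.
- exact: subgroupD.
set a := (X in X *: _); rewrite -(natr_Zp a) scaler_nat !raddfMn.
apply: subgroupMn => //.
have : (enum P)`_i \in P by rewrite -mem_enum mem_nth -?cardE.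
by move/asboolP.
Qed.

(** An isomorphism of A onto B restricts to a bijection of A[p] onto B[p]. *)
Lemma dimv_eq_of_isomorphic (A B : set G) (f : G -> G)
    (U V : {vspace 'rV['F_p]_n}) :
  subgroup A -> {in A &, {morph f : x y / x + y}} -> set_bij A B f ->
  (forall r, r \in U <-> A (val (point r))) ->
  (forall r, r \in V <-> B (val (point r))) -> \dim U = \dim V.
Proof.
move=> sA fD [fAB finj fsurj] UP VP.
have f0 : f 0 = 0.
  apply: (addrI (f 0)); rewrite -fD ?addr0 //; exact: mem_set (subgroup0 sA).
have fMn x m : A x -> f (x *+ m) = f x *+ m.
  move=> Ax; elim: m => [//|m IHm]; rewrite !mulrS fD ?IHm //;
    apply: mem_set => //.
  exact: subgroupMn.
have point_onto x : x *+ p = 0 -> exists r, val (point r) = x.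
  by move=> /socleP[s ->]; exists (coord s); rewrite coordK.
pose R r s := f (val (point r)) = val (point s).
have point_inj r s : val (point r) = val (point s) -> r = s.
  by move=> /val_inj rs; exact: (can_inj pointK).
apply/eqP; rewrite eqn_leq; apply/andP; split.
  apply: (@dimv_leq_of_rel _ _ _ R) => [r /UP Ar|r r' s /UP Ar /UP Ar' Rr Rr'].
    have [s Rs] : exists s, val (point s) = f (val (point r)).
      by apply: point_onto; rewrite -fMn // val_socle_mulrn.
    by exists s => //; apply/VP; rewrite Rs; exact: fAB.
  by apply/point_inj/finj; rewrite ?inE // -/(R r s) Rr Rr'.
apply: (@dimv_leq_of_rel _ _ _ (fun s r => R r s)) =>
  [s /VP Bs|s s' r _ _ Rs Rs'].
  have [x Ax fx] := fsurj _ Bs.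
  have [r rx] : exists r, val (point r) = x.
    apply: point_onto; apply: finj; rewrite ?inE ?f0.
    - exact: subgroupMn.
    - exact: subgroup0.
    - by rewrite fMn // fx val_socle_mulrn.
  by exists r; [apply/UP; rewrite rx | rewrite /R rx].
by apply: point_inj; rewrite -Rs -Rs'.
Qed.

(** The component in A of a p-th part of x is again a p-th part of x. *)
Lemma direct_sum_p_divisible (A H : set G) : direct_sum A H ->
  forall x, A x -> exists2 y, A y & y *+ p = x.
Proof.
move=> [sA sH AH AH0] x Ax; have [y yx] := divG x;
  have [a [h [Aa Hh yah]]] := AH y.
exists a => //; apply/eqP; rewrite eq_sym -subr_eq0; apply/eqP.
suff : (A `&` H) (x - a *+ p) by rewrite AH0.
split; first by apply: subgroupB => //; exact: subgroupMn.
by rewrite -yx yah mulrnDl addrC addKr; exact: subgroupMn.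
Qed.

(** By directness, the components of an element killed by p are killed by
    p. *)
Lemma direct_sum_socle (A H : set G) (s : socle G p_pr) : direct_sum A H ->
  exists a h, [/\ A (val a), H (val h) & s = a + h].
Proof.
move=> [sA sH AH AH0]; have [a [h [Aa Hh sah]]] := AH (val s).
have ahp : a *+ p + h *+ p = 0 by rewrite -mulrnDl -sah val_socle_mulrn.
have ap : a *+ p = 0.
  suff : (A `&` H) (a *+ p) by rewrite AH0.
  split; first exact: subgroupMn.
  by rewrite (eqP (_ : a *+ p == - (h *+ p))) -?addr_eq0 ?ahp //;
    apply: subgroupN => //; exact: subgroupMn.
have hp : h *+ p = 0 by rewrite ap add0r in ahp.
have [a' a'E] := socleP ap; have [h' h'E] := socleP hp.
exists a', h'; rewrite -a'E -h'E; split=> //.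
by apply: val_inj; rewrite sah a'E h'E raddfD.
Qed.

Lemma direct_sumC (A H : set G) : direct_sum A H -> direct_sum H A.
Proof.
move=> [sA sH AH AH0]; split=> // [x|]; last by rewrite setIC.
by have [a [h [Aa Hh ->]]] := AH x; exists h, a; rewrite addrC.
Qed.

(** The intersection of A and C has trivial socle and their sum is p-divisible
    and contains the socle of G. *)
Lemma direct_sum_of_complementary (A C : set G) (U W : {vspace 'rV['F_p]_n}) :
  subgroup A -> subgroup C ->
  (forall x, A x -> exists2 y, A y & y *+ p = x) ->
  (forall x, C x -> exists2 y, C y & y *+ p = x) ->
  (forall r, r \in U <-> A (val (point r))) ->
  (forall r, r \in W <-> C (val (point r))) ->
  complementary U W -> direct_sum A C.
Proof.
move=> sA sC divA divC UP WP [UW UW0].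
have sAC : subgroup [set x | exists a c, [/\ A a, C c & x = a + c]].
  apply/subgroupP; split; first by exists 0, 0; rewrite addr0; split=> //;
    exact: subgroup0.
  move=> _ _ [a [c [Aa Cc ->]]] [a' [c' [Aa' Cc' ->]]].
  exists (a - a'), (c - c'); rewrite opprD addrACA; split=> //;
    exact: subgroupB.
split=> //.
  apply: (p_subgroup_full pG sAC) =>
    [_ [a [c [/divA[a' Aa' <-] /divC[c' Cc' <-] ->]]]|].
    by exists (a' + c'); [exists a', c' | rewrite mulrnDl].
  move=> _ /socleP[s ->]; have : coord s \in (U + W)%VS by rewrite UW memvf.
  move=> /memv_addP[u /UP Au [w /WP Cw suw]].
  exists (val (point u)), (val (point w)); split=> //.
  by rewrite -(coordK s) suw !raddfD.
apply/seteqP; split=> [x ACx|_ ->]; last by split; exact: subgroup0.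
have sI : subgroup (A `&` C).
  apply/subgroupP; split; first by split; exact: subgroup0.
  by move=> y z [Ay Cy] [Az Cz]; split; exact: subgroupB.
apply: (p_subgroup_trivial pG sI) ACx => y [Ay Cy] /socleP[s sy]; move: Ay Cy.
rewrite {}sy -{1 2}(coordK s) => /UP Us /WP Ws.
have : coord s \in (U :&: W)%VS by rewrite memv_cap Us Ws.
by rewrite UW0 memv0 => /eqP s0; rewrite -(coordK s) s0 !raddf0.
Qed.

(** Every complement W of A[p] in the socle is the socle of a p-divisible
    subgroup, when A is a summand. The projection onto W along A[p] maps H[p]
    isomorphically onto W; its lift f is therefore injective on H, and f(H)
    inherits the divisibility of H. *)
Lemma p_divisible_lift (A H : set G) (U W : {vspace 'rV['F_p]_n}) :
  direct_sum A H -> (forall r, r \in U <-> A (val (point r))) ->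
    complementary U W ->
  exists C : set G, [/\ subgroup C,
    forall x, C x -> exists2 y, C y & y *+ p = x &
    forall r, r \in W <-> C (val (point r))].
Proof.
move=> AH UP [UW UW0]; have [sA sH _ AH0] := AH.
have WU0 : (W :&: U)%VS = 0%VS by rewrite capvC.
pose pi := daddv_pi W U.
have pi_ker r : pi r = 0 <-> r \in U.
  have rWU : r \in (W + U)%VS by rewrite addvC UW memvf.
  have pi_sum := daddv_pi_add WU0 rWU.
  split=> [pr0|rU]; first by rewrite -pi_sum -/pi pr0 add0r memv_pi.
  by move: pi_sum; rewrite (daddv_pi_id UW0 rU) => /eqP;
    rewrite -subr_eq0 addrK => /eqP.
pose phi s := val (point (pi (coord s))).
have phiB : zmod_morphism phi by move=> s t; rewrite /phi !raddfB.
pose Phi : {additive socle G p_pr -> G} :=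
  HB.pack phi (GRing.isZmodMorphism.Build _ _ phi phiB).
have [f fE] := hom_extension p_pr pG (fun _ _ => divG) Phi val_inj.
have injf x : H x -> f x = 0 -> x = 0.
  move=> Hx fx0.
  have sK : subgroup [set x | H x /\ f x = 0].
    apply/subgroupP; split=> [|y z [Hy fy] [Hz fz]].
      by split; [exact: subgroup0 | rewrite raddf0].
    by split; [exact: subgroupB | rewrite raddfB fy fz subrr].
  apply: (p_subgroup_trivial pG sK) (conj Hx fx0) => {Hx fx0}.
  move=> y [Hy fy0] /socleP[s ys]; move: Hy fy0; rewrite {}ys fE => Hs phis.
  suff : (A `&` H) (val s) by rewrite AH0.
  split=> //; rewrite -(coordK s); apply/UP/pi_ker.
  have : point (pi (coord s)) = 0 by apply: val_inj; rewrite raddf0;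
    exact: phis.
  by move=> /(congr1 coord); rewrite pointK raddf0.
exists (f @` H); split.
- exact: subgroup_image.
- move=> _ [x Hx <-]; have [y Hy <-] :=
    direct_sum_p_divisible (direct_sumC AH) Hx.
  by exists (f y); [exists y | rewrite raddfMn].
move=> r; split=> [rW|[h Hh fh]].
  have [a [h [Aa Hh sah]]] := direct_sum_socle (point r) AH.
  exists (val h) => //; rewrite fE /Phi /= /phi; congr (val (point _)).
  have pia0 : pi (coord a) = 0 by apply/pi_ker/UP; rewrite coordK.
  rewrite -[RHS](daddv_pi_id WU0 rW) -/pi.
  have piD x y : pi (x + y) = pi x + pi y by exact: raddfD.
  by rewrite -[X in _ = pi X]pointK sah raddfD piD pia0 add0r.
have /socleP[t ht] : h *+ p = 0.
  by apply: injf; [exact: subgroupMn | rewrite raddfMn fh val_socle_mulrn].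
move: fh; rewrite ht fE => /val_inj/(can_inj pointK) <-.
exact: memv_pi.
Qed.

Lemma finite_rank_perspective : perspective G.
Proof.
move=> A H B K AH BK [f [fD fbij]].
have [sA _ _ _] := AH; have [sB _ _ _] := BK.
have [U UP] := subgroup_vspace sA; have [V VP] := subgroup_vspace sB.
have dimUV := dimv_eq_of_isomorphic sA fD fbij UP VP.
have [W [UW VW]] := vspace_common_complement dimUV.
have [C [sC divC WP]] := p_divisible_lift AH UP UW.
exists C; split.
  exact: (direct_sum_of_complementary sA sC (direct_sum_p_divisible AH) divC
    UP WP UW).
exact: (direct_sum_of_complementary sB sC (direct_sum_p_divisible BK) divC VP
  WP VW).
Qed.

End FiniteRank.
End PGroup.

Theorem proposition3p6 (p : nat) (p_pr : prime p) (G : zmodType) :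
  divisible G -> p_group p G ->
  (perspective G <-> finite_rank p_pr G) /\
  (finite_rank p_pr G ->
   exists n : nat, isomorphic G {ffun 'I_n -> prufer p}).
Proof.
move=> divG pG.
have pdivG : p_divisible p G by move=> x; apply: divG; exact: prime_gt0.
have coordinates : finite_rank p_pr G -> exists n
    (coord : {linear socle G p_pr -> 'rV['F_p]_n})
    (point : {linear 'rV['F_p]_n -> socle G p_pr}),
    cancel coord point /\ cancel point coord.
  move=> [n [[c clin [d cK dK]]]]; exists n.
  pose coord : {linear socle G p_pr -> 'rV['F_p]_n} :=
    HB.pack c (GRing.isLinear.Build _ _ _ _ c clin).
  have dlin : linear d := can2_linear (cK : cancel coord d) dK.
  pose point : {linear 'rV['F_p]_n -> socle G p_pr} :=
    HB.pack d (GRing.isLinear.Build _ _ _ _ d dlin).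
  by exists coord, point.
split; first split.
- exact: perspective_finite_rank.
- by move=> /coordinates[n [coord [point [cK pK]]]];
    exact: finite_rank_perspective cK pK.
- move=> /coordinates[n [coord [point [cK pK]]]]; exists n.
  exact: finite_rank_isomorphic cK pK.
Qed.
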